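(* Let $n\ge1$ and let $(Q,\sigma)$ be the equioriented symmetric quiver of type $A_{2n}$: vertices $1,\dots,2n$, arrows $a_i:i\to i+1$ ($1\le i\le 2n-1$), $\sigma(i)=2n+1-i$, $\sigma(a_i)=a_{2n-i}$. Let $\alpha$ be a symmetric dimension vector, written $(\alpha_1,\dots,\alpha_n)$ with $\alpha_i=\alpha_{2n+1-i}$, and for $V\in SpRep(Q,\alpha)$ write $V(a_i)$ for the linear maps of the corresponding symplectic representation (so $V(a_n):V_n\to V_n^*$ is symmetric and $V(a_{2n-i})=-V(a_i)^t$). Then $SpSI(Q,\alpha)$ is generated by the following semi-invariants: (i) $\det(V(a_i)\cdots V(a_j))$ for $1\le j\le i\le n-1$ such that $\alpha_j=\alpha_{i+1}<\min\{\alpha_{j+1},\dots,\alpha_i\}$ (the condition on the minimum being vacuous when $i=j$); (ii) $\det(V(a_{2n-i})\cdots V(a_i))$ (a map $V_i\to V_{2n+1-i}\cong V_i^*$) for $1\le i\le n$ such that $\alpha_i<\min\{\alpha_{i+1},\dots,\alpha_n\}$ (vacuous when $i=n$).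
   Context: $\mathbb{K}$ is algebraically closed of characteristic 0. For a symmetric quiver $(Q,\sigma)$ (involution $\sigma$ of vertices and arrows reversing arrows, with $\sigma(a)=a$ whenever $\sigma(ta)=ha$) and symmetric dimension vector $\alpha$, here $Q_0^+=\{1,\dots,n\}$, $Q_1^+=\{a_1,\dots,a_{n-1}\}$, $Q_1^\sigma=\{a_n\}$, and $SpRep(Q,\alpha)=\bigoplus_{i=1}^{n-1}\mathrm{Hom}(\mathbb{K}^{\alpha_i},\mathbb{K}^{\alpha_{i+1}})\oplus S_2(\mathbb{K}^{\alpha_n})^*$ with the action of $SSp(Q,\alpha)=\prod_{i=1}^n SL(\alpha_i)$ by $g\cdot V=(g_{ha}V(a)g_{ta}^{-1})$, $g_{\sigma(x)}:=(g_x^{-1})^t$; $SpSI(Q,\alpha)=\mathbb{K}[SpRep(Q,\alpha)]^{SSp(Q,\alpha)}$. *)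

(* Defs.v *)
From HB Require Import structures.
From mathcomp Require Import all_boot all_order all_algebra.
Set Implicit Arguments. Unset Strict Implicit. Unset Printing Implicit Defensive.
Import GRing.Theory.
Local Open Scope ring_scope.

Section SymQuiver.
Variables (K : fieldType) (n : nat) (alpha : nat -> nat).

(* A point of SpRep(Q,alpha): V.1 i : 'M_(alpha (i+1), alpha i) is V(a_i) for
   1 <= i <= n-1 (other indices are unused dummies), and V.2 : 'M_(alpha n)
   is the Gram matrix of V(a_n) : V_n -> V_n^*, required symmetric. *)
Definition SpRepT : Type :=
  ((forall i : nat, 'M[K]_(alpha i.+1, alpha i)) * 'M[K]_(alpha n))%type.

Definition valid_rep (V : SpRepT) : Prop := V.2^T = V.2.

Definition GroupT : Type := forall i : nat, 'M[K]_(alpha i).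
Definition in_SSp (g : GroupT) : Prop :=
  forall i, (1 <= i <= n)%N -> \det (g i) = 1.

(* g . V = (g_{h a} V(a) g_{t a}^{-1}), with g_{sigma(n)} = (g_n^{-1})^t. *)
Definition act (g : GroupT) (V : SpRepT) : SpRepT :=
  (fun i => if (1 <= i <= n.-1)%N then g i.+1 *m V.1 i *m invmx (g i) else V.1 i,
   (invmx (g n))^T *m V.2 *m invmx (g n)).

Inductive in_subalg (S : (SpRepT -> K) -> Prop) : (SpRepT -> K) -> Prop :=
| sa_gen f : S f -> in_subalg S f
| sa_const (c : K) : in_subalg S (fun _ => c)
| sa_add f h : in_subalg S f -> in_subalg S h -> in_subalg S (fun V => f V + h V)
| sa_mul f h : in_subalg S f -> in_subalg S h -> in_subalg S (fun V => f V * h V).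

Definition coord_fun (f : SpRepT -> K) : Prop :=
  (exists i (r : 'I_(alpha i.+1)) (c : 'I_(alpha i)),
      (1 <= i <= n.-1)%N /\ f = fun V => V.1 i r c)
  \/ (exists (r c : 'I_(alpha n)), f = fun V => V.2 r c).

Definition is_poly_fun (f : SpRepT -> K) : Prop :=
  exists p, in_subalg coord_fun p /\ forall V, valid_rep V -> f V = p V.

Definition is_invariant (f : SpRepT -> K) : Prop :=
  forall g V, in_SSp g -> valid_rep V -> f (act g V) = f V.

Definition in_SpSI (f : SpRepT -> K) : Prop := is_poly_fun f /\ is_invariant f.

Fixpoint prodA (V : SpRepT) (j k : nat) : 'M[K]_(alpha (k + j), alpha j) :=
  match k with
  | 0 => 1%:M
  | k'.+1 => V.1 (k' + j) *m prodA V j k'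
  end.

Definition sqdet m p (M : 'M[K]_(m, p)) : K := \det (conform_mx (0 : 'M[K]_p) M).

Definition semi_inv1 (i j : nat) (V : SpRepT) : K :=
  sqdet (prodA V j (i - j).+1).

(* (ii): det(V(a_{2n-i}) ... V(a_i)), using V(a_{2n-k}) = - V(a_k)^t:
   = det((-1)^(n-i) (A_{n-1}..A_i)^t V(a_n) (A_{n-1}..A_i)) *)
Definition semi_inv2 (i : nat) (V : SpRepT) : K :=
  let P := prodA V i (n - i) in
  \det ((-1) ^+ (n - i) *:
        ((P^T) *m conform_mx (0 : 'M[K]_(alpha ((n - i) + i))) V.2 *m P)).

Definition cond1 (i j : nat) : bool :=
  [&& (1 <= j)%N, (j <= i)%N, (i <= n.-1)%N, alpha j == alpha i.+1 &
      [forall k : 'I_i.+1, (j < k)%N ==> (alpha j < alpha k)%N]].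

Definition cond2 (i : nat) : bool :=
  [&& (1 <= i)%N, (i <= n)%N &
      [forall k : 'I_n.+1, (i < k)%N ==> (alpha i < alpha k)%N]].

Definition generator (f : SpRepT -> K) : Prop :=
  (exists i j, cond1 i j /\ f = semi_inv1 i j)
  \/ (exists i, cond2 i /\ f = semi_inv2 i).

End SymQuiver.

(* Main.v *)
Require Import Defs.
From HB Require Import structures.
From mathcomp Require Import all_boot all_order all_algebra.
From mathcomp Require Import perm zify ring.
Local Open Scope ring_scope.
Import GRing.Theory.

(** Write [A_i] for [V(a_i)] and [B] for the symmetric form on the last vertex.
    The slice consists of the representations in which every [A_i] and [B] is a
    rectangular identity matrix, except that the last diagonal entry of the
    matrix leaving vertex [j] is a free parameter [t_j] whenever a generator
    starts at [j], i.e. unless the first later dimension not exceeding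
    [alpha_j] is strictly smaller.  On the slice the generators of type (i), and
    the one of type (ii) at vertex [n], take the value [t_j], and those of type
    (ii) at [j < n] take the value [+- t_j^2]; sign changes coming from the group
    show that an invariant is even in the latter parameters.  Hence every
    invariant agrees on the slice with a polynomial in the generators.

    It remains to see that an invariant [f] vanishing on the slice is zero.
    Gaussian elimination by unitriangular matrices makes [A_1], ..., [A_(n-1)],
    [B] diagonal as long as the pivots are nonzero: an upper unitriangular
    change of basis at vertex [k] can be compensated at all vertices before [k]
    where the matrices are already diagonal.  A zero pivot is avoided by moving
    along a line, on which [f] is a univariate polynomial.  Finally, diagonal
    matrices of determinant 1 bring a diagonal representation with nonzero
    entries to the slice. *)

(** * Matrices read at natural-number positions, transvections, one elimination step *)

Section NatIndexedMatrices.
Set Implicit Arguments. Unset Strict Implicit.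
Variable K : fieldType.

Definition nmx m p (F : nat -> nat -> K) : 'M[K]_(m, p) := \matrix_(x, y) F x y.

Definition dmx m p (d : nat -> K) : 'M[K]_(m, p) :=
  nmx m p (fun x y => if x == y then d y else 0).

(** Out-of-range positions read as 0, so one formula serves all vertices, whatever their
    dimensions. *)
Definition entry m p (M : 'M[K]_(m, p)) (x y : nat) : K :=
  if insub x is Some i then if insub y is Some j then M i j else 0 else 0.

Lemma entryE m p (M : 'M[K]_(m, p)) (x : 'I_m) (y : 'I_p) : entry M x y = M x y.
Proof. by rewrite /entry !valK. Qed.

Lemma entry_out m p (M : 'M[K]_(m, p)) x y :
  ~~ ((x < m) && (y < p))%N -> entry M x y = 0.
Proof.
rewrite negb_and /entry; case/orP=> h; first by rewrite insubN.
by case: insubP => // i _ _; rewrite insubN.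
Qed.

Lemma mul_dmxl m q p (d : nat -> K) (M : 'M[K]_(q, p)) :
  dmx m q d *m M = nmx m p (fun x y => d x * entry M x y).
Proof.
apply/matrixP=> x y; rewrite !mxE.
have [xq|xq] := ltnP x q; last first.
  rewrite entry_out ?mulr0; last by rewrite negb_and -leqNgt xq.
  rewrite big1 // => z _; rewrite !mxE; case: eqP => [e|]; last by rewrite mul0r.
  by have := ltn_ord z; rewrite -e ltnNge xq.
rewrite (bigD1 (Ordinal xq)) //= big1 ?addr0.
  by rewrite !mxE /= eqxx -(entryE M (Ordinal xq)).
move=> z zx; rewrite !mxE; case: eqP => [e|]; last by rewrite mul0r.
by case/eqP: zx; apply: val_inj.
Qed.

Lemma trmx_nmx m p F : (nmx m p F)^T = nmx p m (fun x y => F y x).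
Proof. by apply/matrixP=> x y; rewrite !mxE. Qed.

Lemma eq_nmx m p (F G : nat -> nat -> K) :
  (forall x y, (x < m)%N -> (y < p)%N -> F x y = G x y) -> nmx m p F = nmx m p G.
Proof. by move=> h; apply/matrixP=> x y; rewrite !mxE h. Qed.

Lemma trmx_dmx m p d : (dmx m p d)^T = dmx p m d.
Proof.
rewrite /dmx trmx_nmx; apply: eq_nmx => x y _ _.
by rewrite eq_sym; case: eqP => [->|].
Qed.

Lemma entry_nmx m p F x y :
  (x < m)%N -> (y < p)%N -> entry (nmx m p F) x y = F x y.
Proof.
by move=> xm yp; rewrite (entryE (nmx m p F) (Ordinal xm) (Ordinal yp)) mxE.
Qed.

Lemma mul_dmx m q p (d d' : nat -> K) :
  (forall x, (x < m)%N -> (x < p)%N -> (x < q)%N) ->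
  dmx m q d *m dmx q p d' = dmx m p (fun x => d x * d' x).
Proof.
move=> h; rewrite mul_dmxl; apply: eq_nmx => x y xm yp.
have [e|ne] := eqVneq x y.
  by rewrite -e in yp *; rewrite entry_nmx ?h // eqxx.
have [xq|xq] := ltnP x q; first by rewrite entry_nmx // (negPf ne) mulr0.
by rewrite entry_out ?mulr0 // negb_and -leqNgt xq.
Qed.

Lemma det_dmx m (d : nat -> K) : \det (dmx m m d) = \prod_(x < m) d x.
Proof.
rewrite det_trig; first by apply: eq_bigr => i _; rewrite !mxE eqxx.
by apply/is_trig_mxP=> i j; rewrite !mxE; case: eqP => // ->; rewrite ltnn.
Qed.

(** This is [1 + e_r u]: upper unitriangular when [u] vanishes up to [r], and the identity when
    [r >= m]. *)
Definition transvection m (r : nat) (u : nat -> K) : 'M[K]_m :=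
  nmx m m (fun x y => (x == y)%:R + (x == r)%:R * u y).

Lemma mul_transvectionl m p (r : nat) u (M : 'M[K]_(m, p)) x y :
  (transvection m r u *m M) x y = M x y + (x == r :> nat)%:R * \sum_(z < m) u z * M z y.
Proof.
rewrite !mxE; under eq_bigr do rewrite !mxE mulrDl.
rewrite big_split /= (bigD1 x) //= eqxx mul1r big1 ?addr0; last first.
  by move=> z; rewrite eq_sym => /negPf; rewrite -val_eqE /= => ->; rewrite mul0r.
by congr (_ + _); rewrite mulr_sumr; apply: eq_bigr => z _; rewrite mulrA.
Qed.

Lemma mul_transvectionr m p (r : nat) u (M : 'M[K]_(p, m)) x y :
  (M *m transvection m r u) x y = M x y + entry M x r * u y.
Proof.
rewrite !mxE; under eq_bigr do rewrite !mxE mulrDr.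
rewrite big_split /= (bigD1 y) //= eqxx mulr1 big1 ?addr0; last first.
  by move=> z /negPf; rewrite -val_eqE /= => ->; rewrite mulr0.
congr (_ + _); have [rm|rm] := ltnP r m.
  rewrite (bigD1 (Ordinal rm)) //= eqxx mul1r big1 ?addr0.
    by rewrite (entryE M x (Ordinal rm)).
  move=> z; rewrite -val_eqE /= => /negPf ->; by rewrite mul0r mulr0.
rewrite entry_out ?mul0r; last by rewrite negb_and -(leqNgt m) rm orbT.
rewrite big1 // => z _; have -> : (z == r :> nat) = false.
  by apply/eqP=> e; have := ltn_ord z; rewrite e ltnNge rm.
by rewrite mul0r mulr0.
Qed.

Lemma det_transvection m r u :
  (forall y, (y <= r)%N -> u y = 0) -> \det (transvection m r u) = 1.
Proof.
move=> u0; rewrite -det_tr det_trig; last first.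
  apply/is_trig_mxP=> i j ij; rewrite !mxE gtn_eqF // add0r.
  by case: eqP => [e|]; rewrite ?mul0r // u0 ?mulr0 // -e ltnW.
rewrite big1 // => i _; rewrite !mxE eqxx.
by case: eqP => [e|]; rewrite ?mul0r ?addr0 // u0 ?mulr0 ?addr0 // e.
Qed.

Definition reduced r m p (M : 'M[K]_(m, p)) : Prop :=
  forall (x : 'I_m) (y : 'I_p), (x < r)%N || (y < r)%N ->
    if x == y :> nat then M x y != 0 else M x y == 0.

Lemma reduced_full r s m p (M : 'M[K]_(m, p)) :
  (m <= r)%N || (p <= r)%N -> reduced r M -> reduced s M.
Proof.
by move=> h Mr x y _; apply: Mr; have := ltn_ord x; have := ltn_ord y; lia.
Qed.

Lemma entry_diag_neq0 m p r x (M : 'M[K]_(m, p)) :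
  reduced r M -> (x < r)%N -> (x < m)%N -> (x < p)%N -> entry M x x != 0.
Proof.
move=> Mr xr xm xp; have := Mr (Ordinal xm) (Ordinal xp).
by rewrite /= xr eqxx -entryE; apply.
Qed.

Lemma entry_offdiag m p r x y (M : 'M[K]_(m, p)) :
  reduced r M -> (x < r)%N || (y < r)%N -> x != y -> entry M x y = 0.
Proof.
move=> Mr xr xy; have [/andP[xm yp]|] := boolP ((x < m) && (y < p))%N; last exact: entry_out.
have := Mr (Ordinal xm) (Ordinal yp).
by rewrite /= xr (negPf xy) -entryE => /(_ isT)/eqP.
Qed.

(** Both products change only row [r] of [M], adding [u y * M_yy] on one side and [M_rr * u' y] on
    the other. The division-free hypothesis also covers [r] out of range. *)
Lemma transvection_dmx m p r (M : 'M[K]_(m, p)) u u' :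
  (forall s, reduced s M) ->
  (forall y, u y * entry M y y = entry M r r * u' y) ->
  transvection m r u *m M = M *m transvection p r u'.
Proof.
move=> Mr h; apply/matrixP=> x y; rewrite mul_transvectionl mul_transvectionr.
congr (_ + _).
have -> : \sum_(z < m) u z * M z y = u y * entry M y y.
  have [ym|ym] := ltnP y m.
    rewrite (bigD1 (Ordinal ym)) //= -(entryE M (Ordinal ym)) big1 ?addr0 //.
    move=> z; rewrite -val_eqE /= => zy.
    by rewrite -entryE (@entry_offdiag _ _ y.+1) ?mulr0 // ltnSn orbT.
  rewrite entry_out ?mulr0; last by rewrite negb_and -(leqNgt m) ym.
  rewrite big1 // => z _; rewrite -entryE (@entry_offdiag _ _ y.+1) ?mulr0 //.
    by rewrite ltnSn orbT.
  by have := ltn_ord z; lia.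
rewrite h; case: eqP => [->|/eqP xr]; rewrite ?mul1r // mul0r.
by rewrite (@entry_offdiag _ _ x.+1) ?ltnSn // mul0r.
Qed.

(* One step of Gaussian elimination on the pivot [(r, r)]; the pivot itself is
   kept, hence the case distinction. *)
Definition pivoted r m p (M : 'M[K]_(m, p)) : 'M[K]_(m, p) :=
  nmx m p (fun x y => if (x == r) && (y == r) then entry M r r
                      else entry M x y - entry M x r * entry M r y / entry M r r).

Definition pivot_row r m p (M : 'M[K]_(m, p)) y :=
  if (r < y)%N then entry M r y / entry M r r else 0.

Lemma pivoted_row r m p (M : 'M[K]_(m, p)) y :
  entry M r r != 0 -> (r < m)%N -> (y < p)%N ->
  entry (pivoted r M) r y = if y == r then entry M r r else 0.
Proof.
move=> c0 rm yp; rewrite entry_nmx // eqxx /=; case: eqP => // _.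
by rewrite mulrAC divff // mul1r subrr.
Qed.

Lemma pivoted_col r m p (M : 'M[K]_(m, p)) x :
  entry M r r != 0 -> (x < m)%N -> (r < p)%N ->
  entry (pivoted r M) x r = if x == r then entry M r r else 0.
Proof.
move=> c0 rm yp; rewrite entry_nmx // eqxx /= andbT; case: eqP => // _.
by rewrite -mulrA divff // mulr1 subrr.
Qed.

Lemma pivoted_reduced r m p (M : 'M[K]_(m, p)) :
  (r < m)%N -> (r < p)%N -> entry M r r != 0 ->
  reduced r M -> reduced r.+1 (pivoted r M).
Proof.
move=> rm rp c0 Mr x y; rewrite -entryE => xy.
have [ex|nx] := eqVneq (x : nat) r.
  by rewrite ex pivoted_row // eq_sym; case: eqP.
have [ey|ny] := eqVneq (y : nat) r.
  by rewrite ey pivoted_col // (negPf nx).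
have xyr : (x < r)%N || (y < r)%N by lia.
rewrite entry_nmx // (negPf nx) /=.
have -> : entry M x r * entry M r y = 0.
  case/orP: xyr => h; first by rewrite (entry_offdiag Mr) ?h ?mul0r.
  by rewrite mulrC (entry_offdiag Mr) ?h ?mul0r ?orbT // eq_sym.
by rewrite mul0r subr0 entryE; apply: Mr.
Qed.

(** Column [r] is cleared by a lower unitriangular factor on the left and row [r] by an upper one on
    the right; the inverse of the latter is moved to the other side. *)
Lemma mul_pivoted r m p (M : 'M[K]_(m, p)) :
  (r < m)%N -> (r < p)%N -> entry M r r != 0 -> reduced r M ->
  pivoted r M *m transvection p r (pivot_row r M) =
  (transvection m r (fun x => - pivot_row r M^T x))^T *m M.
Proof.
move=> rm rp c0 Mr.
have eT x y : entry M^T x y = entry M y x.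
  rewrite /entry; case: (insub x) => [i|]; case: (insub y) => [j|] //.
  by rewrite mxE.
rewrite -{4}(trmxK M) -trmx_mul; apply/matrixP=> x y.
rewrite [RHS]mxE !mul_transvectionr eT.
rewrite [X in X + _ = _]mxE [X in _ = X + _]mxE -entryE pivoted_col //.
rewrite /pivot_row !eT.
have [ex|nx] := eqVneq (x : nat) r; have [ey|ny] := eqVneq (y : nat) r => /=.
- by rewrite ex ey ltnn oppr0 !mulr0.
- rewrite ex ltnn oppr0 mulr0 addr0; case: ltnP => h.
    by field.
  by rewrite (entry_offdiag Mr (x := r) (y := y)) ?mulr0 ?mul0r ?subr0 ?addr0 //; lia.
- rewrite ey ltnn mulr0 addr0; case: ltnP => h; first by field.
  by rewrite (entry_offdiag Mr (x := x) (y := r)) ?mul0r ?oppr0 ?mulr0 ?subr0 //; lia.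
- rewrite mul0r addr0; case: ltnP => h; first by field.
  by rewrite (entry_offdiag Mr (x := x) (y := r)) ?mul0r ?oppr0 ?mulr0 ?subr0 ?addr0 //; lia.
Qed.

Lemma mul_pivoted_sym r m (M : 'M[K]_m) :
  M^T = M -> (r < m)%N -> entry M r r != 0 -> reduced r M ->
  (transvection m r (pivot_row r M))^T *m
    (pivoted r M *m transvection m r (pivot_row r M)) = M.
Proof.
move=> sM rm c0 Mr; rewrite mul_pivoted // sM mulmxA -trmx_mul.
(* Transvections in the same row [r] with [u r = 0] compose by adding the rows, so opposite ones are
   inverse. *)
have -> : transvection m r (fun x => - pivot_row r M x) *m
          transvection m r (pivot_row r M) = 1%:M.
  apply/matrixP=> x y; rewrite mul_transvectionr !mxE.
  rewrite entry_nmx // /pivot_row ltnn oppr0 mulr0 addr0 -val_eqE /=.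
  by rewrite mulrN -addrA addNr addr0.
by rewrite trmx1 mul1mx.
Qed.

End NatIndexedMatrices.

(** * Polynomial functions on representations; the generators are semi-invariants *)

Section SemiInvariants.
Set Implicit Arguments. Unset Strict Implicit.
Variables (K : fieldType) (n : nat) (alpha : nat -> nat).
Hypothesis hn : (1 <= n)%N.
Local Notation rep := (SpRepT K n alpha).
Implicit Types (f h : rep -> K) (V W : rep) (g : GroupT K alpha).

Lemma is_poly_fun_ext f h : f =1 h -> is_poly_fun f -> is_poly_fun h.
Proof. by move=> e [p [pp fp]]; exists p; split=> // V vV; rewrite -e fp. Qed.

Lemma is_poly_fun_const c : @is_poly_fun K n alpha (fun _ => c).
Proof. by exists (fun _ => c); split=> //; apply: sa_const. Qed.

Lemma is_poly_funD f h : is_poly_fun f -> is_poly_fun h -> is_poly_fun (fun V => f V + h V).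
Proof.
move=> [p [pp fp]] [q [qp hq]]; exists (fun V => p V + q V).
by split=> [|V vV]; [apply: sa_add | rewrite fp ?hq].
Qed.

Lemma is_poly_funM f h : is_poly_fun f -> is_poly_fun h -> is_poly_fun (fun V => f V * h V).
Proof.
move=> [p [pp fp]] [q [qp hq]]; exists (fun V => p V * q V).
by split=> [|V vV]; [apply: sa_mul | rewrite fp ?hq].
Qed.

Lemma is_poly_fun_sum (I : Type) (s : seq I) (F : I -> rep -> K) :
  (forall i, is_poly_fun (F i)) -> is_poly_fun (fun V => \sum_(i <- s) F i V).
Proof.
move=> pF; elim: s => [|i s IH].
  by apply: is_poly_fun_ext (is_poly_fun_const 0) => V; rewrite big_nil.
by apply: is_poly_fun_ext (is_poly_funD (pF i) IH) => V; rewrite big_cons.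
Qed.

Lemma is_poly_fun_prod (I : Type) (s : seq I) (F : I -> rep -> K) :
  (forall i, is_poly_fun (F i)) -> is_poly_fun (fun V => \prod_(i <- s) F i V).
Proof.
move=> pF; elim: s => [|i s IH].
  by apply: is_poly_fun_ext (is_poly_fun_const 1) => V; rewrite big_nil.
by apply: is_poly_fun_ext (is_poly_funM (pF i) IH) => V; rewrite big_cons.
Qed.

Definition is_poly_mx m p (M : rep -> 'M[K]_(m, p)) : Prop :=
  forall x y, is_poly_fun (fun V => M V x y).

Lemma is_poly_mx_mul m p q (M : rep -> 'M[K]_(m, p)) (N : rep -> 'M[K]_(p, q)) :
  is_poly_mx M -> is_poly_mx N -> is_poly_mx (fun V => M V *m N V).
Proof.
move=> pM pN x y.
apply: is_poly_fun_ext (is_poly_fun_sum (index_enum _)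
  (fun z => is_poly_funM (pM x z) (pN z y))) => V.
by rewrite mxE.
Qed.

Lemma is_poly_mx_conform m p (B : 'M[K]_p) (M : rep -> 'M[K]_(m, p)) :
  is_poly_mx M -> is_poly_mx (fun V => conform_mx B (M V)).
Proof.
move=> pM; have [e|ne] := eqVneq m p.
  case: _ / e B M pM => B M pM x y; apply: is_poly_fun_ext (pM x y) => V.
  by rewrite conform_mx_id.
move=> x y; apply: is_poly_fun_ext (is_poly_fun_const (B x y)) => V.
by rewrite nonconform_mx ?ne.
Qed.

Lemma is_poly_fun_det m (M : rep -> 'M[K]_m) :
  is_poly_mx M -> is_poly_fun (fun V => \det (M V)).
Proof.
move=> pM; apply: is_poly_fun_ext (is_poly_fun_sum (index_enum _)
  (fun s : 'S_m => is_poly_funM (is_poly_fun_const ((-1) ^+ s))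
   (is_poly_fun_prod (index_enum _) (fun i => pM i (s i))))) => V.
by [].
Qed.

Lemma is_poly_mx_prodA j k :
  (1 <= j)%N -> (k + j <= n)%N -> is_poly_mx (fun V : rep => prodA V j k).
Proof.
move=> j1; elim: k => [|k IH] kn.
  move=> x y; exact: is_poly_fun_const.
apply: is_poly_mx_mul => [x y|]; last by apply: IH; lia.
exists (fun V => V.1 (k + j)%N x y); split=> //; apply: sa_gen; left.
by exists (k + j)%N, x, y; split=> //; lia.
Qed.

Lemma is_poly_mx_form : is_poly_mx (fun V : rep => V.2).
Proof.
move=> x y; exists (fun V => V.2 x y); split=> //.
by apply: sa_gen; right; exists x, y.
Qed.

Lemma is_poly_semi_inv1 i j :
  (1 <= j)%N -> (j <= i)%N -> (i <= n.-1)%N -> is_poly_fun (@semi_inv1 K n alpha i j).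
Proof.
move=> j1 ji i_n; apply: is_poly_fun_det; apply: is_poly_mx_conform.
by apply: is_poly_mx_prodA => //; lia.
Qed.

Lemma is_poly_semi_inv2 i :
  (1 <= i)%N -> (i <= n)%N -> is_poly_fun (@semi_inv2 K n alpha i).
Proof.
move=> i1 i_n; apply: is_poly_fun_det => x y.
have pP : is_poly_mx (fun V : rep => prodA V i (n - i)).
  by apply: is_poly_mx_prodA => //; lia.
have pQ : is_poly_mx (fun V : rep =>
    (prodA V i (n - i))^T *m conform_mx (0 : 'M_(alpha (n - i + i))) V.2 *m
    prodA V i (n - i)).
  apply: is_poly_mx_mul => //; apply: is_poly_mx_mul.
    by move=> z w; apply: is_poly_fun_ext (pP w z) => V; rewrite mxE.
  have e : alpha (n - i + i) = alpha n by rewrite subnK.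
  move: (alpha (n - i + i)) e => m ->.
  by move=> z w; apply: is_poly_fun_ext (is_poly_mx_form z w) => V; rewrite conform_mx_id.
apply: is_poly_fun_ext (is_poly_funM (is_poly_fun_const ((-1) ^+ (n - i))) (pQ x y)) => V.
by rewrite [RHS]mxE.
Qed.

Lemma in_SSp_unit g i : in_SSp n g -> (1 <= i <= n)%N -> g i \in unitmx.
Proof. by move=> gS /gS; rewrite unitmxE => ->; rewrite unitr1. Qed.

Lemma prodA_act g V j k : in_SSp n g -> (1 <= j)%N -> (k + j <= n)%N ->
  prodA (act g V) j k = g (k + j)%N *m prodA V j k *m invmx (g j).
Proof.
move=> gS j1; elim: k => [|k IH] kn.
  by rewrite /= mulmx1 mulmxV // in_SSp_unit //; lia.
rewrite [LHS]/= IH; last by lia.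
have -> : (1 <= k + j <= n.-1)%N by lia.
by rewrite !mulmxA mulmxKV // in_SSp_unit //; lia.
Qed.

Lemma sqdet_mul m p (L : 'M[K]_m) (M : 'M[K]_(m, p)) (R : 'M[K]_p) :
  m = p -> sqdet (L *m M *m R) = \det L * sqdet M * \det R.
Proof. by move=> e; case: _ / e M R => M R; rewrite /sqdet !conform_mx_id !det_mulmx. Qed.

Lemma conform_form_act g V k : k = n ->
  conform_mx (0 : 'M[K]_(alpha k)) (act g V).2 =
  (invmx (g k))^T *m conform_mx (0 : 'M[K]_(alpha k)) V.2 *m invmx (g k).
Proof. by move=> ->; rewrite !conform_mx_id. Qed.

(** [cond1] makes the product square, so the action multiplies its determinant by determinants of
    group elements, all equal to 1. *)
Lemma semi_inv1_invariant i j :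
  cond1 n alpha i j -> is_invariant (@semi_inv1 K n alpha i j).
Proof.
case/and5P=> j1 ji i_n /eqP e _ g V gS _.
rewrite /semi_inv1 prodA_act //; last by lia.
rewrite sqdet_mul; last by rewrite e; congr alpha; lia.
by rewrite det_inv !gS ?invr1 ?mul1r ?mulr1 //; lia.
Qed.

Lemma semi_inv2_invariant i :
  (1 <= i)%N -> (i <= n)%N -> is_invariant (@semi_inv2 K n alpha i).
Proof.
move=> i1 i_n g V gS _.
rewrite /semi_inv2 prodA_act ?subnK // conform_form_act ?subnK //.
set h := g (n - i + i)%N; set B := conform_mx _ _; set P := prodA _ _ _.
have uh : h \in unitmx by apply: in_SSp_unit => //; lia.
(* The group element at vertex [n] cancels on both sides of the form, leaving a congruence by
   [invmx (g i)]. *)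
rewrite !trmx_mul !mulmxA -(mulmxA _ h^T) -(trmx_mul (invmx h)) mulVmx // trmx1 mulmx1.
rewrite mulmxKV // -!mulmxA scalemxAr det_mulmx det_tr det_inv gS; last by lia.
rewrite invr1 mul1r !mulmxA scalemxAl det_mulmx det_inv gS ?invr1 ?mulr1 //; lia.
Qed.

Lemma generator_in_SpSI f : generator f -> in_SpSI f.
Proof.
case=> [[i [j [c ->]]]|[i [/and3P[i1 i_n _] ->]]].
  split; last exact: semi_inv1_invariant.
  by case/and5P: c => *; apply: is_poly_semi_inv1.
by split; [apply: is_poly_semi_inv2 | apply: semi_inv2_invariant].
Qed.

Lemma in_SpSI_sub f h : in_SpSI f -> in_SpSI h -> in_SpSI (fun V => f V - h V).
Proof.
move=> [pf If] [ph Ih]; split=> [|g V gS vV]; last by rewrite If ?Ih.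
apply: is_poly_fun_ext (is_poly_funD pf (is_poly_funM (is_poly_fun_const (-1)) ph)) => V.
by rewrite mulN1r.
Qed.

Lemma subalg_in_SpSI f : in_subalg (@generator K n alpha) f -> in_SpSI f.
Proof.
elim=> [{}f /generator_in_SpSI //|c|{}f h _ [pf If] _ [ph Ih]|{}f h _ [pf If] _ [ph Ih]].
- by split=> //; apply: is_poly_fun_const.
- by split=> [|g V gS vV]; [apply: is_poly_funD | rewrite If ?Ih].
- by split=> [|g V gS vV]; [apply: is_poly_funM | rewrite If ?Ih].
Qed.

End SemiInvariants.

(** * Invariants on diagonal representations and on the slice *)

Section DiagonalRepresentations.
Set Implicit Arguments. Unset Strict Implicit.
Variables (K : fieldType) (n : nat) (alpha : nat -> nat).
Hypothesis hn : (1 <= n)%N.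
Local Notation rep := (SpRepT K n alpha).
Implicit Types (f h : rep -> K) (V W : rep) (g : GroupT K alpha).

(** A representation also carries matrices at dummy indices, and families are compared only
    pointwise; a polynomial function reads just the arrows [1 <= i < n] and the form. *)
Lemma in_SpSI_agree f V W : in_SpSI f -> valid_rep V -> valid_rep W ->
  (forall i, (1 <= i < n)%N -> V.1 i = W.1 i) -> V.2 = W.2 -> f V = f W.
Proof.
move=> [[p [pp fp]] _] vV vW e1 e2; rewrite !fp //.
elim: pp => [q|//|q q' _ IH _ IH'|q q' _ IH _ IH']; last 2 first.
- by rewrite IH IH'.
- by rewrite IH IH'.
case=> [[i [x [y [hi ->]]]]|[x [y ->]]]; last by rewrite e2.
by rewrite e1 //; lia.
Qed.

Lemma valid_act g V : valid_rep V -> valid_rep (act g V).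
Proof. by rewrite /valid_rep /= => vV; rewrite !trmx_mul trmxK vV mulmxA. Qed.

(** The two equations express [W = g . V] without inverses. *)
Lemma in_SpSI_move f g V W : in_SpSI f -> in_SSp n g -> valid_rep V -> valid_rep W ->
  (forall i, (1 <= i < n)%N -> W.1 i *m g i = g i.+1 *m V.1 i) ->
  (g n)^T *m (W.2 *m g n) = V.2 -> f W = f V.
Proof.
move=> fS gS vV vW e1 e2; have [_ If] := fS.
rewrite -(If _ _ gS vV); apply: in_SpSI_agree => //; first exact: valid_act.
  move=> i hi /=; have -> : (1 <= i <= n.-1)%N by lia.
  by rewrite -e1 // mulmxK // (in_SSp_unit gS) //; lia.
have u : g n \in unitmx by apply: (in_SSp_unit gS); lia.
by rewrite /= -e2 !mulmxA -trmx_mul mulmxV // trmx1 mul1mx mulmxK.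
Qed.

Lemma sqdet_dmx m p (d : nat -> K) :
  m = p -> sqdet (dmx m p d) = \prod_(x < p) d x.
Proof. by move=> ->; rewrite /sqdet conform_mx_id det_dmx. Qed.

Lemma conform_dmx m m' (d : nat -> K) :
  m = m' -> conform_mx (0 : 'M_m') (dmx m m d) = dmx m' m' d.
Proof. by move=> ->; rewrite conform_mx_id. Qed.

Lemma eq_dmx m p (d d' : nat -> K) :
  (forall x, (x < m)%N -> (x < p)%N -> d x = d' x) -> dmx m p d = dmx m p d'.
Proof.
by move=> h; apply: eq_nmx => x y xm yp; case: eqP => // e; rewrite h -?e // e.
Qed.

Lemma prod_single m b (c : K) :
  (b < m)%N -> \prod_(x < m) (if x == b :> nat then c else 1) = c.
Proof.
move=> bm; rewrite (bigD1 (Ordinal bm)) //= eqxx big1 ?mulr1 // => x.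
by rewrite -val_eqE /= => /negPf ->.
Qed.

Definition diagrep (a : nat -> nat -> K) : rep :=
  (fun i => dmx (alpha i.+1) (alpha i) (a i), dmx (alpha n) (alpha n) (a n)).

Lemma valid_diagrep a : valid_rep (diagrep a).
Proof. exact: trmx_dmx. Qed.

(** No intermediate vertex is smaller than vertex [j], so no diagonal position is lost on the
    way. *)
Lemma prodA_diagrep a j k : (forall l, (l < k)%N -> (alpha j <= alpha (l + j))%N) ->
  prodA (diagrep a) j k = dmx _ _ (fun y => \prod_(l < k) a (l + j)%N y).
Proof.
elim: k => [|k IH] h /=.
  apply/matrixP=> x y; rewrite !mxE -val_eqE; case: eqP => // _.
  by rewrite big_ord0.
rewrite IH => [|l lk]; last by apply: h; lia.
rewrite mul_dmx => [|x _ xj]; last exact: leq_trans xj (h k (ltnSn k)).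
by apply: eq_dmx => x _ _; rewrite big_ord_recr /= mulrC.
Qed.

Lemma in_SpSI_torus f (d a a' : nat -> nat -> K) : in_SpSI f ->
  (forall i, (1 <= i <= n)%N -> \prod_(x < alpha i) d i x = 1) ->
  (forall i x, (1 <= i < n)%N -> (x < alpha i)%N -> (x < alpha i.+1)%N ->
     a' i x * d i x = d i.+1 x * a i x) ->
  (forall x, (x < alpha n)%N -> d n x * (a' n x * d n x) = a n x) ->
  f (diagrep a') = f (diagrep a).
Proof.
move=> fS d1 e1 e2.
apply: (@in_SpSI_move f (fun i => dmx _ _ (d i))) => //; try exact: valid_diagrep.
- by move=> i hi; rewrite det_dmx d1.
- move=> i hi; rewrite /= !mul_dmx //; apply: eq_dmx => x xm xp; exact: e1.
- by rewrite /= trmx_dmx !mul_dmx //; apply: eq_dmx => x xm _; apply: e2.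
Qed.

(* [drops p m] says that the first vertex [k] in [m, n] with [alpha k <= p.+1]
   exists and satisfies [alpha k <= p]; [d] is the number of vertices left. *)
Fixpoint drops_rec p d m : bool :=
  if d is d'.+1 then
    (alpha m <= p)%N || (p.+1 < alpha m)%N && drops_rec p d' m.+1
  else false.

Definition drops p m := drops_rec p (n.+1 - m) m.

Lemma dropsE p m : (m <= n)%N ->
  drops p m = (alpha m <= p)%N || (p.+1 < alpha m)%N && drops p m.+1.
Proof. by move=> mn; rewrite /drops subSn. Qed.

Lemma drops_last p m : (n < m)%N -> drops p m = false.
Proof. by move=> nm; rewrite /drops (eqP nm). Qed.

Definition free_vertex i := ~~ drops (alpha i).-1 i.+1.

Lemma cond2P i : cond2 n alpha i ->
  [/\ (1 <= i)%N, (i <= n)%N & forall k, (i < k)%N -> (k <= n)%N -> (alpha i < alpha k)%N].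
Proof.
case/and3P=> i1 i_n /forallP h; split=> // k ik kn.
by have := h (Ordinal (kn : (k < n.+1)%N)); rewrite /= ik.
Qed.

(** The two alternatives lead to generators of type (ii) and of type (i) respectively. *)
Lemma drops_recPn p d m : ~~ drops_rec p d m ->
  (forall k, (m <= k < m + d)%N -> (p.+1 < alpha k)%N) \/
  (exists k, [/\ (m <= k < m + d)%N, alpha k = p.+1 &
               forall l, (m <= l < k)%N -> (p.+1 < alpha l)%N]).
Proof.
elim: d m => [|d IH] m /=; first by left=> k; lia.
rewrite negb_or -ltnNge => /andP[pm].
have [e _|ne] := eqVneq (alpha m) p.+1.
  by right; exists m; split=> // [|l]; lia.
have pm1 : (p.+1 < alpha m)%N by lia.
rewrite pm1 /= => /IH [h|[k [km ek h]]].
  left=> k km; have [->//|nk] := eqVneq k m; apply: h; lia.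
right; exists k; split=> // [|l lk]; first lia.
have [->//|nk] := eqVneq l m; apply: h; lia.
Qed.

Lemma free_vertexP j : (1 <= j <= n)%N -> (0 < alpha j)%N -> free_vertex j ->
  cond2 n alpha j \/ exists i, cond1 n alpha i j.
Proof.
move=> jn a0 /drops_recPn; rewrite (prednK a0) => -[h|[k [hk ek h]]].
  left; apply/and3P; split; try lia.
  by apply/forallP=> k; apply/implyP=> jk; apply: h; have := ltn_ord k; lia.
(* The composite ends at vertex [k], so its last arrow is the one leaving [k.-1]. *)
right; exists k.-1; apply/and5P; split; try lia.
  by rewrite (ltn_predK (m := j)) ?ek //; lia.
by apply/forallP=> l; apply/implyP=> jl; apply: h; have := ltn_ord l; lia.
Qed.

Lemma cond2_free i : cond2 n alpha i -> free_vertex i.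
Proof.
case/cond2P=> _ _ h; rewrite /free_vertex /drops.
have: forall k, (i.+1 <= k < i.+1 + (n.+1 - i.+1))%N -> (alpha i < alpha k)%N.
  by move=> k hk; apply: h; lia.
move: (n.+1 - i.+1)%N => d; move: i.+1 => m; elim: d m => //= d IH m hm.
have am : (alpha i < alpha m)%N by apply: hm; lia.
rewrite negb_or negb_and; apply/andP; split; first lia.
by rewrite IH ?orbT // => k hk; apply: hm; lia.
Qed.

Definition section_param (t : nat -> K) i x : K :=
  if (x.+1 == alpha i) && free_vertex i then t i else 1.

Definition slice t : rep := diagrep (section_param t).

Definition flip j (t : nat -> K) i : K := if i == j then - t i else t i.

(* The sign change is realised by [-1] in positions [alpha j - 1] and [alpha j]
   at all vertices after [j]; these positions exist since [alpha j] is smaller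
   than all later dimensions. *)
Lemma slice_even f t j : in_SpSI f -> cond2 n alpha j -> (j < n)%N ->
  (0 < alpha j)%N -> f (slice (flip j t)) = f (slice t).
Proof.
move=> fS c2 jn a0; have [j1 _ h] := cond2P c2; have fj := cond2_free c2.
pose d i x : K := if (j < i)%N then
  (if x == (alpha j).-1 then -1 else 1) * (if x == alpha j then -1 else 1) else 1.
have dd i x : d i x * d i x = 1.
  by rewrite /d; do ![case: ifP => _]; rewrite ?mulr1 ?mul1r ?mulrNN ?mulr1.
apply: (@in_SpSI_torus _ d) => // [i hi|i x hi xi xi1|x xn].
- rewrite /d; case: ltnP => ji; last by rewrite big1.
  have ai : (alpha j < alpha i)%N by apply: h; lia.
  by rewrite big_split /= !prod_single ?mulrNN ?mulr1 //; lia.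
- rewrite /section_param /flip; have [e|ne] := eqVneq i j; last first.
    have -> : d i.+1 x = d i x by rewrite /d ltnS leq_eqVlt eq_sym (negPf ne).
    by rewrite mulrC.
  (* At the arrow leaving [j] only the target is rescaled, and [alpha j] is not a column index
     there, so just the last diagonal entry changes sign. *)
  rewrite e in xi *; rewrite /d ltnn ltnSn fj andbT mulr1.
  have -> : (x == (alpha j).-1) = (x.+1 == alpha j) by lia.
  have -> : (x == alpha j) = false by lia.
  by rewrite mulr1; case: ifP => _; rewrite ?mulN1r ?mulr1.
- rewrite mulrCA dd mulr1 /section_param /flip.
  by have -> : (n == j) = false by lia.
Qed.

Lemma section_param1 t i x : (x.+1 < alpha i)%N -> section_param t i x = 1.
Proof. by move=> h; rewrite /section_param ltn_eqF. Qed.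

Lemma section_param_free t i x : free_vertex i ->
  section_param t i x = if x.+1 == alpha i then t i else 1.
Proof. by rewrite /section_param => ->; rewrite andbT. Qed.

(** The later dimensions exceed [alpha j], so only the first factor has a parameter at a position
    below [alpha j]. *)
Lemma prod_section t j k y : free_vertex j -> (y < alpha j)%N ->
  (forall l, (0 < l)%N -> (l <= k)%N -> (alpha j < alpha (l + j))%N) ->
  \prod_(l < k.+1) section_param t (l + j)%N y = if y == (alpha j).-1 then t j else 1.
Proof.
move=> fj yj h; rewrite big_ord_recl big1 => [|l _]; last first.
  by rewrite section_param1 //; apply: leq_ltn_trans yj (h l.+1 _ _).
rewrite mulr1 /= add0n section_param_free //; congr (if _ then _ else _); lia.
Qed.

Lemma semi_inv1_slice t i j : cond1 n alpha i j -> (0 < alpha j)%N ->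
  free_vertex j -> semi_inv1 i j (slice t) = t j.
Proof.
case/and5P=> j1 ji i_n /eqP e /forallP h a0 fj.
have hl l : (0 < l)%N -> (l <= i - j)%N -> (alpha j < alpha (l + j))%N.
  move=> l0 li; have li' : (l + j < i.+1)%N by lia.
  by have /implyP := h (Ordinal li'); apply=> /=; lia.
rewrite /semi_inv1 prodA_diagrep => [|l lk]; last first.
  by case: (posnP l) => [->//|l0]; apply: ltnW; apply: hl.
rewrite sqdet_dmx; last by rewrite e; congr alpha; lia.
under eq_bigr do rewrite prod_section //.
by rewrite prod_single //; lia.
Qed.

(** For [j < n] the parameter enters once through [P] and once through its transpose, hence the
    square; for [j = n] it is an entry of the form. The sign comes from a scalar on a matrix of size
    [alpha j]. *)
Lemma semi_inv2_slice t j : cond2 n alpha j -> (0 < alpha j)%N ->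
  semi_inv2 j (slice t) =
  ((-1) ^+ (n - j)) ^+ alpha j * (if j == n then t j else t j ^+ 2).
Proof.
move=> c2 a0; have [j1 jn h] := cond2P c2; have fj := cond2_free c2.
rewrite /semi_inv2 detZ; congr (_ * _).
rewrite prodA_diagrep => [|l lk]; last first.
  by case: (posnP l) => [->//|l0]; apply: ltnW; apply: h; lia.
have ae : alpha n = alpha (n - j + j) by rewrite subnK.
have jle : (alpha j <= alpha n)%N.
  by have [->//|ne] := eqVneq j n; apply/ltnW/h; lia.
rewrite /= conform_dmx // trmx_dmx.
rewrite mul_dmx => [|x _ //]; rewrite mul_dmx => [|x xj _]; last by rewrite -ae; lia.
rewrite det_dmx; have [e|ne] := eqVneq j n.
  rewrite -[RHS](@prod_single (alpha j) (alpha j).-1) ?prednK //.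
  apply: eq_bigr => x _; have -> : (n - j = 0)%N by lia.
  rewrite !big_ord0 mul1r mulr1 -e section_param_free //.
  congr (if _ then _ else _); have := ltn_ord x; lia.
rewrite -[RHS](@prod_single (alpha j) (alpha j).-1) ?prednK //.
apply: eq_bigr => x _; have -> : (n - j = (n - j).-1.+1)%N by lia.
rewrite prod_section //; last by move=> l l0 lk; apply: h; lia.
rewrite section_param1; last by have := h n; have := ltn_ord x; lia.
by rewrite mulr1; case: ifP => _; rewrite ?mulr1 ?expr2.
Qed.

Definition squared m j :=
  [&& (j < m)%N, cond2 n alpha j, (j < n)%N & (0 < alpha j)%N].

(** Polynomials in the free parameters where [t j] enters only through its square when
    [squared m j]. Letting [m] grow from 0 to [n] treats evenness one vertex at a time. *)
Inductive param_alg (m : nat) : ((nat -> K) -> K) -> Prop :=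
| param_const c : param_alg m (fun _ => c)
| param_var j : (1 <= j <= n)%N -> (0 < alpha j)%N -> free_vertex j ->
    ~~ squared m j -> param_alg m (fun t => t j)
| param_sqr j : squared m j -> param_alg m (fun t => t j ^+ 2)
| param_add q r : param_alg m q -> param_alg m r -> param_alg m (fun t => q t + r t)
| param_mul q r : param_alg m q -> param_alg m r -> param_alg m (fun t => q t * r t).

Lemma param_alg_slice p : in_subalg (@coord_fun K n alpha) p ->
  exists2 q, param_alg 0 q & forall t, p (slice t) = q t.
Proof.
have diag m k i (x : 'I_m) (y : 'I_k) : (1 <= i <= n)%N ->
    exists2 q, param_alg 0 q & forall t, dmx m k (section_param t i) x y = q t.
  move=> hi; have [e|ne] := eqVneq (x : nat) y; last first.
    by exists (fun _ => 0) => [|t]; [apply: param_const | rewrite mxE (negPf ne)].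
  have [/andP[/eqP ay fi]|nf] := boolP ((y.+1 == alpha i) && free_vertex i).
    exists (fun t => t i); first by apply: param_var => //; lia.
    by move=> t; rewrite mxE e eqxx /section_param ay fi eqxx.
  exists (fun _ => 1) => [|t]; first exact: param_const.
  by rewrite mxE e eqxx /section_param (negPf nf).
elim=> [_ [[i [x [y [hi ->]]]]|[x [y ->]]]|c|f h _ [q pq eq] _ [r pr er]
       |f h _ [q pq eq] _ [r pr er]].
- by apply: diag; lia.
- by apply: diag; lia.
- by exists (fun _ => c) => //; apply: param_const.
- by exists (fun t => q t + r t) => [|t]; [apply: param_add | rewrite eq er].
- by exists (fun t => q t * r t) => [|t]; [apply: param_mul | rewrite eq er].
Qed.

Lemma squaredS m j : j != m -> squared m.+1 j = squared m j.
Proof. by move=> ne; rewrite /squared ltnS leq_eqVlt (negPf ne). Qed.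

(** These are the even and odd parts in [t m]; a factor [t m ^+ 2] arising in a product is absorbed
    by the even part. *)
Lemma param_alg_split m q : squared m.+1 m -> param_alg m q ->
  exists q0 q1, [/\ param_alg m.+1 q0, param_alg m.+1 q1 &
                    forall t, q t = q0 t + t m * q1 t].
Proof.
move=> sm; have c c0 : param_alg m.+1 (fun _ => c0) by apply: param_const.
elim=> [c0|j jn a0 fj nsj|j sj|{}q r _ [q0 [q1 [pq0 pq1 eq]]] _ [r0 [r1 [pr0 pr1 er]]]
       |{}q r _ [q0 [q1 [pq0 pq1 eq]]] _ [r0 [r1 [pr0 pr1 er]]]].
- by exists (fun _ => c0), (fun _ => 0); split=> // t; rewrite mulr0 addr0.
- have [->|ne] := eqVneq j m.
    by exists (fun _ => 0), (fun _ => 1); split=> // t; rewrite mulr1 add0r.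
  exists (fun t => t j), (fun _ => 0); split=> // [|t]; last by rewrite mulr0 addr0.
  by apply: param_var; rewrite // squaredS.
- exists (fun t => t j ^+ 2), (fun _ => 0); split=> // [|t]; last by rewrite mulr0 addr0.
  by apply: param_sqr; rewrite squaredS //; case/andP: sj; lia.
- exists (fun t => q0 t + r0 t), (fun t => q1 t + r1 t).
  by split=> [||t]; [apply: param_add|apply: param_add|rewrite eq er; ring].
- exists (fun t => q0 t * r0 t + t m ^+ 2 * (q1 t * r1 t)),
         (fun t => q0 t * r1 t + q1 t * r0 t); split=> [||t].
  + apply: param_add; first exact: param_mul.
    by apply: param_mul; [apply: param_sqr | apply: param_mul].
  + by apply: param_add; apply: param_mul.
  + by rewrite eq er; ring.
Qed.

Lemma param_alg_flip m q t :
  squared m.+1 m -> param_alg m.+1 q -> q (flip m t) = q t.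
Proof.
move=> sm; elim=> [//|j _ _ _ nsj|j _|{}q r _ eq _ er|{}q r _ eq _ er].
- by rewrite /flip; case: eqP => // e; rewrite e sm in nsj.
- by rewrite /flip; case: eqP; rewrite ?sqrrN.
- by rewrite eq er.
- by rewrite eq er.
Qed.

Lemma param_alg_step m q : (2%:R : K) != 0 -> param_alg m q ->
  (squared m.+1 m -> forall t, q (flip m t) = q t) ->
  exists2 r, param_alg m.+1 r & q =1 r.
Proof.
move=> K2 pq ev; have [sm|nsm] := boolP (squared m.+1 m).
  have [q0 [q1 [pq0 pq1 e]]] := param_alg_split sm pq.
  exists q0 => // t; have := ev sm t.
  (* Comparing [t] with [flip m t] leaves [- t m * q1 t = t m * q1 t], so the odd part vanishes
     because 2 is nonzero. *)
  rewrite !e !(param_alg_flip _ sm) // {1}/flip eqxx => /addrI /eqP.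
  rewrite mulNr eq_sym -addr_eq0 -mulr2n -mulr_natl mulf_eq0 (negPf K2) /=.
  by move/eqP->; rewrite addr0.
exists q => //; elim: pq => [c|j jn a0 fj nsj|j sj|*|*].
- exact: param_const.
- by apply: param_var => //; have [->//|ne] := eqVneq j m; rewrite squaredS.
- by apply: param_sqr; case/and4P: sj => jm *; apply/and4P; split=> //; lia.
- exact: param_add.
- exact: param_mul.
Qed.

Lemma generators_on_slice q : param_alg n q ->
  exists2 h, in_subalg (@generator K n alpha) h & forall t, h (slice t) = q t.
Proof.
elim=> [c|j jn a0 fj nsj|j /and4P[_ c2 jn a0]|{}q r _ [f pf eq] _ [h ph er]
       |{}q r _ [f pf eq] _ [h ph er]].
- by exists (fun _ => c) => //; apply: sa_const.
- case: (free_vertexP jn a0 fj) => [c2|[i c1]].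
    have e : j = n by move: nsj; rewrite /squared c2 a0; lia.
    exists (@semi_inv2 K n alpha j) => [|t].
      by apply: sa_gen; right; exists j.
    by rewrite semi_inv2_slice // e eqxx subnn expr0 expr1n mul1r.
  exists (@semi_inv1 K n alpha i j) => [|t]; last exact: semi_inv1_slice.
  by apply: sa_gen; left; exists i, j.
(* The constant cancels the sign in the value of [semi_inv2] on the slice. *)
- exists (fun V => ((-1) ^+ (n - j)) ^+ alpha j * semi_inv2 j V) => [|t].
    by apply: sa_mul; [apply: sa_const | apply: sa_gen; right; exists j].
  rewrite semi_inv2_slice // ltn_eqF // mulrA -exprMn -exprMn mulrNN mulr1.
  by rewrite !expr1n mul1r.
- by exists (fun V => f V + h V) => [|t]; [apply: sa_add | rewrite eq er].
- by exists (fun V => f V * h V) => [|t]; [apply: sa_mul | rewrite eq er].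
Qed.

Lemma in_SpSI_on_slice f : (2%:R : K) != 0 -> in_SpSI f ->
  exists2 h, in_subalg (@generator K n alpha) h & forall t, f (slice t) = h (slice t).
Proof.
move=> K2 fS; have [[p [pp fp]] _] := fS.
have H m : exists2 q, param_alg m q & forall t, f (slice t) = q t.
  elim: m => [|m [q pq eq]].
    have [q pq eq] := param_alg_slice pp; exists q => // t.
    by rewrite fp ?eq //; apply: valid_diagrep.
  have [|r pr er] := param_alg_step K2 pq; last by exists r => // t; rewrite eq er.
  by case/and4P=> _ c2 mn a0 t; rewrite -!eq slice_even.
have [q pq eq] := H n; have [h ph eh] := generators_on_slice pq.
by exists h => // t; rewrite eq eh.
Qed.

End DiagonalRepresentations.

(** * Scaling diagonal representations into the slice *)

Section TorusNormalisation.
Set Implicit Arguments. Unset Strict Implicit.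
Variables (K : fieldType) (n : nat) (alpha : nat -> nat).
Hypothesis hn : (1 <= n)%N.
Variables (b : nat -> nat -> K) (rt : nat -> K).
Hypothesis b_neq0 : forall i x, b i x != 0.
Hypothesis rt_sqr : forall x, rt x ^+ 2 = b n x.

(* For a fixed position [p], the scaling factor is prescribed (by [y]) at the
   vertices of dimension [p.+1], and is propagated from the nearest such vertex
   to the right, or from the left when the dimension drops to at most [p]
   before such a vertex is met. *)
Fixpoint right_value p (y : nat -> K) d m : K :=
  if alpha m == p.+1 then y m
  else if d is d'.+1 then b m p * right_value p y d' m.+1 else rt p.

Fixpoint left_value p (y : nat -> K) m : K :=
  if m is m'.+1 then
    if alpha m == p.+1 then y m else (b m' p)^-1 * left_value p y m'
  else 1.

Definition column p y m :=
  if drops n alpha p m then left_value p y m else right_value p y (n - m) m.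

Lemma column_neq0 p y m : (forall i, y i != 0) -> column p y m != 0.
Proof.
move=> y0; rewrite /column; case: ifP => _.
  by elim: m => [|m IH] /=; rewrite ?oner_neq0 //; case: ifP; rewrite ?mulf_neq0 ?invr_neq0.
move: (n - m)%N => d; elim: d m => [|d IH] i /=; case: ifP => _ //; rewrite ?mulf_neq0 //.
by have := b_neq0 n p; rewrite -rt_sqr expf_eq0.
Qed.

Lemma column_prescribed p y m : (m <= n)%N -> alpha m = p.+1 -> column p y m = y m.
Proof.
move=> mn am; rewrite /column dropsE // am ltnn ltnn /=.
by case: (n - m)%N => [|d] /=; rewrite am eqxx.
Qed.

(** A vertex of dimension [p.+1] that is not free is followed by a drop, so the next vertex takes
    its value from the left, hence from this one. If the dimension is larger, both vertices draw on
    the same side and the recursion gives the relation. *)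
Lemma column_step p y i : (1 <= i < n)%N -> (p < alpha i)%N -> (p < alpha i.+1)%N ->
  ~~ ((p.+1 == alpha i) && free_vertex n alpha i) ->
  column p y i = column p y i.+1 * b i p.
Proof.
move=> /andP[i1 i_n] pi pi1; have [e|ne] /= := eqVneq p.+1 (alpha i).
  rewrite /free_vertex negbK -e /= => dr.
  rewrite column_prescribed //; last by lia.
  rewrite /column dr /=.
  have /negPf-> : alpha i.+1 != p.+1.
    by move: dr; rewrite dropsE //; apply: contraTneq => ->; rewrite !ltnn.
  rewrite mulrAC mulVf // mul1r; case: i i1 e {i_n pi pi1 dr} => // i _ e.
  by rewrite /= -e eqxx.
move=> _; rewrite /column dropsE; last by lia.
have -> : (alpha i <= p)%N = false by lia.
have -> : (p.+1 < alpha i)%N by lia.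
rewrite /=; case: ifP => dr.
  have /negPf-> : alpha i.+1 != p.+1.
    by move: dr; rewrite dropsE // => h; apply: contraTneq h => ->; rewrite !ltnn.
  by rewrite mulrAC mulVf // mul1r.
have -> : (n - i = (n - i.+1).+1)%N by lia.
by rewrite /= eq_sym (negPf ne) mulrC.
Qed.

(** The form is scaled by squares, which is why propagation from the right starts with the square
    root [rt p]. *)
Lemma column_last p y : (p.+1 < alpha n)%N -> column p y n ^+ 2 = b n p.
Proof.
move=> pn; rewrite /column dropsE // drops_last // andbF orbF.
have -> : (alpha n <= p)%N = false by lia.
by rewrite subnn /= gtn_eqF.
Qed.

(** The product of the scaling factors at positions below [p]. Its inverse is prescribed wherever
    [p] is the last position, which forces determinant 1. *)
Fixpoint partial_prod p i : K :=
  if p is p'.+1 then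
    partial_prod p' i * column p' (fun k => (partial_prod p' k)^-1) i
  else 1.

Definition scaling i p : K := column p (fun k => (partial_prod p k)^-1) i.

Lemma partial_prod_neq0 p i : partial_prod p i != 0.
Proof.
elim: p i => [|p IH] i /=; first exact: oner_neq0.
by rewrite mulf_neq0 // column_neq0 // => k; rewrite invr_neq0.
Qed.

Lemma scaling_neq0 i p : scaling i p != 0.
Proof. by apply: column_neq0 => k; rewrite invr_neq0 // partial_prod_neq0. Qed.

Lemma prod_scaling i : (i <= n)%N -> \prod_(x < alpha i) scaling i x = 1.
Proof.
move=> i_n.
have -> m : \prod_(x < m) scaling i x = partial_prod m i.
  by elim: m => [|m IH]; rewrite ?big_ord0 // big_ord_recr /= IH.
case e : (alpha i) => [|p] //=.
by rewrite column_prescribed // mulfV // partial_prod_neq0.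
Qed.

Lemma in_SpSI_diagrep (f : SpRepT K n alpha -> K) : in_SpSI f ->
  exists t, f (diagrep n alpha b) = f (slice n alpha t).
Proof.
move=> fS.
exists (fun i => let p := (alpha i).-1 in if i == n then b n p / scaling n p ^+ 2
  else scaling i.+1 p * b i p / scaling i p).
symmetry; apply: (in_SpSI_torus hn fS (d := scaling)) => [i hi|i x hi xi xi1|x xn].
- by apply: prod_scaling; lia.
- rewrite /section_param; case: ifP => [/andP[/eqP e _]|/negbT nf].
    rewrite -e /= ltn_eqF; last by lia.
    by rewrite divfK // scaling_neq0.
  by rewrite mul1r; apply: column_step.
rewrite /section_param eqxx; case: ifP => [/andP[/eqP e _]|/negbT nf].
  by rewrite -e /= mulrCA -expr2 divfK // expf_neq0 // scaling_neq0.
rewrite mul1r -expr2; apply: column_last.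
(* Vertex [n] is always free, so [nf] excludes exactly the last position. *)
move: nf; rewrite /free_vertex drops_last // andbT; lia.
Qed.

End TorusNormalisation.

(** * Elimination to diagonal form, and vanishing from the slice *)

Section Elimination.
Set Implicit Arguments. Unset Strict Implicit.
Variables (K : closedFieldType) (n : nat) (alpha : nat -> nat).
Hypothesis hn : (1 <= n)%N.
Local Notation rep := (SpRepT K n alpha).
Implicit Types (V W : rep).
Variable f : rep -> K.
Hypothesis fS : in_SpSI f.

Lemma in_subalg_line p V W : in_subalg (@coord_fun K n alpha) p ->
  exists q : {poly K}, forall t,
    p (fun i => V.1 i + t *: W.1 i, V.2 + t *: W.2) = q.[t].
Proof.
elim=> [_ [[i [x [y [hi ->]]]]|[x [y ->]]]|c|g h _ [q eq] _ [r er]|g h _ [q eq] _ [r er]].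
- exists ((V.1 i x y)%:P + 'X * (W.1 i x y)%:P) => t.
  by rewrite /= !mxE !hornerE.
- exists ((V.2 x y)%:P + 'X * (W.2 x y)%:P) => t.
  by rewrite /= !mxE !hornerE.
- by exists c%:P => t; rewrite hornerC.
- by exists (q + r) => t; rewrite hornerD eq er.
- by exists (q * r) => t; rewrite hornerM eq er.
Qed.

Lemma vanish_line V W t0 : valid_rep V -> valid_rep W ->
  (forall t, t != t0 -> f (fun i => V.1 i + t *: W.1 i, V.2 + t *: W.2) = 0) ->
  f V = 0.
Proof.
move=> vV vW h; have [[p [pp fp]] _] := fS.
have vL t : valid_rep ((fun i => V.1 i + t *: W.1 i, V.2 + t *: W.2) : rep).
  by rewrite /valid_rep /= linearD linearZ /= vV vW.
have [q eq] := in_subalg_line V W pp.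
(* Since [q] vanishes away from [t0], this product vanishes everywhere, hence is zero over an
   algebraically closed field. *)
have q0 : q * ('X - t0%:P) == 0.
  apply: contraT => /closed_nonrootP [t]; rewrite /root hornerM hornerXsubC.
  rewrite mulf_eq0 negb_or subr_eq0 => /andP[qt tt0].
  by rewrite -eq -fp // h ?eqxx in qt.
move: q0; rewrite mulf_eq0 polyXsubC_eq0 orbF => /eqP q0.
have -> : f V = f ((fun i => V.1 i + 0 *: W.1 i, V.2 + 0 *: W.2) : rep).
  by apply: (in_SpSI_agree hn fS) => // [i _|] /=; rewrite scale0r addr0.
by rewrite fp // eq q0 horner0.
Qed.

(** This provides the compensation at earlier vertices: carried back from [k] with rescaled
    coefficients, the transvection leaves the diagonal matrices there unchanged. *)
Lemma pull_transvection k r V (u0 : nat -> K) :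
  (forall y, (y <= r)%N -> u0 y = 0) ->
  (forall i, (1 <= i < k)%N -> forall s, reduced s (V.1 i)) ->
  exists u : nat -> nat -> K,
    [/\ u k = u0, forall i y, (y <= r)%N -> u i y = 0 &
        forall i, (1 <= i < k)%N ->
          transvection (alpha i.+1) r (u i.+1) *m V.1 i =
          V.1 i *m transvection (alpha i) r (u i)].
Proof.
move=> u0r Vr.
pose v := fix v d y : K := if d is d'.+1 then
  v d' y * entry (V.1 (k - d)%N) y y / entry (V.1 (k - d)%N) r r else u0 y.
have vr d y : (y <= r)%N -> v d y = 0.
  by move=> yr; elim: d => [|d IH] /=; rewrite ?u0r // IH !mul0r.
exists (fun i => v (k - i)%N); split=> [|i y|i hi]; rewrite ?subnn //; first exact: vr.
apply: transvection_dmx; first exact: Vr.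
move=> y; have -> : (k - i = (k - i.+1).+1)%N by lia.
rewrite [v _.+1]/=; have -> : (k - (k - i.+1).+1 = i)%N by lia.
have [ri|] := boolP ((r < alpha i.+1) && (r < alpha i))%N.
  have rr0 : entry (V.1 i) r r != 0.
    by case/andP: ri => *; apply: (@entry_diag_neq0 _ _ _ r.+1) => //; apply: Vr.
  by rewrite mulrCA mulfV // mulr1.
(* Here [M_rr] reads as 0, and the other side vanishes too: [u] is 0 up to [r], and beyond [r] the
   diagonal entry is out of range. *)
move=> ri; rewrite [entry _ r r]entry_out // mul0r.
have [yr|ry] := leqP y r; first by rewrite vr // mul0r.
rewrite entry_out ?mulr0 //; lia.
Qed.

Definition pivot k V x y : K :=
  if (k < n)%N then entry (V.1 k) x y else entry V.2 x y.

Definition pivot_ok k r : bool :=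
  (r < alpha k)%N && ((k < n) ==> (r < alpha k.+1))%N.

(** Elimination treats the arrows in order, and [k = n] stands for the form. *)
Definition stage k r V : Prop :=
  [/\ valid_rep V, forall i, (1 <= i < k)%N -> forall s, reduced s (V.1 i) &
      if (k < n)%N then reduced r (V.1 k) else reduced r V.2].

Lemma stage_pivot k r V : (1 <= k <= n)%N -> pivot_ok k r -> pivot k V r r != 0 ->
  stage k r V -> exists2 W, stage k r.+1 W & f W = f V.
Proof.
rewrite /pivot_ok /pivot /stage => /andP[k1 kn].
have rowr m p (M : 'M[K]_(m, p)) y : (y <= r)%N -> pivot_row r M y = 0.
  by rewrite /pivot_row leqNgt => /negPf->.
have [_ If] := fS.
have [kn1|nk] := ltnP k n => /= /andP[rk rk1] c0 [vV Vr Vk].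
  have [u [uk ur ue]] := pull_transvection (rowr _ _ (V.1 k)) Vr.
  (* Column operations at [k] are carried back to all earlier vertices; row operations at [k.+1]
     disturb only what leaves [k.+1], on which [stage] imposes no reduction yet. *)
  pose g : GroupT K alpha := fun i =>
    if (i <= k)%N then transvection (alpha i) r (u i)
    else if i == k.+1 then
      (transvection (alpha i) r (fun x => - pivot_row r (V.1 k)^T x))^T
    else 1%:M.
  have gS : in_SSp n g.
    move=> i hi; rewrite /g; case: ifP => _; first exact: det_transvection (ur i).
    case: ifP => _; last exact: det1.
    by rewrite det_tr det_transvection // => y yr; rewrite rowr // oppr0.
  have gk i : (i <= k)%N -> g i = transvection (alpha i) r (u i) by rewrite /g => ->.
  exists (act g V); last exact: If.
  split; first exact: valid_act.
    move=> i hi s /=; have -> : (1 <= i <= n.-1)%N by lia.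
    have -> : g i.+1 *m V.1 i = V.1 i *m g i by rewrite !gk ?ue //; lia.
    by rewrite mulmxK; [apply: Vr | apply: (in_SSp_unit gS); lia].
  rewrite /=; have -> : (1 <= k <= n.-1)%N by lia.
  have -> : g k.+1 *m V.1 k = pivoted r (V.1 k) *m g k.
    by rewrite /g ltnn eqxx leqnn uk mul_pivoted.
  rewrite mulmxK; first exact: pivoted_reduced.
  by apply: (in_SSp_unit gS); lia.
have ek : k = n by lia.
subst k; have [u [uk ur ue]] := pull_transvection (rowr _ _ V.2) Vr.
pose g : GroupT K alpha := fun i => transvection (alpha i) r (u i).
have gS : in_SSp n g by move=> i hi; apply: det_transvection (ur i).
exists (act g V); last exact: If.
have gu i : (1 <= i <= n)%N -> g i \in unitmx by apply: in_SSp_unit.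
split; first exact: valid_act.
  move=> i hi s /=; have -> : (1 <= i <= n.-1)%N by lia.
  by rewrite ue // mulmxK; [apply: Vr | apply: gu; lia].
rewrite /=.
have -> : V.2 = (g n)^T *m (pivoted r V.2 *m g n).
  by rewrite /g uk mul_pivoted_sym.
rewrite !mulmxA -trmx_mul mulmxV ?trmx1 ?mul1mx ?mulmxK; try by apply: gu; lia.
exact: pivoted_reduced.
Qed.

Definition unit_entry m p (e : bool) r : 'M[K]_(m, p) :=
  nmx m p (fun x y => [&& e, x == r & y == r]%:R).

Lemma reduced_perturb m p r s t e (M : 'M[K]_(m, p)) :
  e ==> (s <= r)%N -> reduced s M -> reduced s (M + t *: unit_entry m p e r).
Proof.
move=> er Ms x y xy; rewrite !mxE.
have -> : [&& e, x == r :> nat & y == r :> nat] = false by lia.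
by rewrite mulr0 addr0; apply: Ms.
Qed.

Lemma entry_perturb m p r t (M : 'M[K]_(m, p)) : (r < m)%N -> (r < p)%N ->
  entry (M + t *: unit_entry m p true r) r r = entry M r r + t.
Proof.
move=> rm rp; rewrite !(entryE _ (Ordinal rm) (Ordinal rp)) !mxE /= eqxx.
by rewrite mulr1.
Qed.

Lemma stage_step k r : (1 <= k <= n)%N ->
  (forall V, stage k r.+1 V -> f V = 0) -> forall V, stage k r V -> f V = 0.
Proof.
move=> hk IH V sV; have [ok|nok] := boolP (pivot_ok k r); last first.
  (* Without a position [(r, r)] the matrix is already fully reduced. *)
  apply: IH; case: sV => vV Vr Vk; split=> //; move: nok Vk; rewrite /pivot_ok.
  case: ifP => kn /= nok; first by apply: reduced_full; lia.
  by apply: reduced_full; have -> : n = k by [lia|]; lia.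
(* Moving along [W] adds [t] to the pivot and changes no other entry, so the pivot vanishes for a
   single [t]. *)
pose W : rep := (fun i => unit_entry _ _ ((i == k) && (k < n)%N) r,
                 unit_entry _ _ (~~ (k < n)%N) r).
have vW : valid_rep W.
  rewrite /valid_rep /= /unit_entry trmx_nmx; apply: eq_nmx => x y _ _.
  by rewrite [(_ == r) && _]andbC.
apply: (@vanish_line V W (- pivot k V r r)) => //; first by case: sV.
move=> t t0; set L : rep := (_, _).
have [||W' sW' <-] := @stage_pivot k r L hk ok; last exact: IH.
- move: t0; rewrite -addr_eq0 addrC; congr (_ != 0); move: ok.
  rewrite /pivot_ok /pivot; case: ifP => kn /= /andP[rk rk1].
    by rewrite eqxx kn entry_perturb.
  have ek : n = k by lia.
  by rewrite kn entry_perturb // ek.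
- case: sV => vV Vr Vk; split.
  + by rewrite /valid_rep /= linearD linearZ /= vV vW.
  + move=> i hi s; apply: reduced_perturb; last exact: Vr.
    by rewrite ltn_eqF //; lia.
  + by move: Vk; case: ifP => kn Vk /=; apply: reduced_perturb; rewrite ?leqnn ?implybT.
Qed.

(** Descending induction on the number of pivots, from [alpha k]: the treated matrix has [alpha k]
    columns and is then completely reduced. *)
Lemma stage_vanish k : (1 <= k <= n)%N ->
  (forall V, (forall r, stage k r V) -> f V = 0) -> forall V, stage k 0 V -> f V = 0.
Proof.
move=> hk H.
have Hr d V : stage k (alpha k - d) V -> f V = 0.
  elim: d V => [|d IH] V.
    rewrite subn0 => sV; apply: H => r; case: sV => vV Vr Vk; split=> //.
    move: Vk; case: ifP => kn; first by apply: reduced_full; rewrite leqnn orbT.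
    by apply: reduced_full; have -> : n = k by [lia|]; rewrite leqnn.
  have [kd|kd] := leqP (alpha k) d.
    have -> : (alpha k - d.+1 = alpha k - d)%N by lia.
    exact: IH.
  apply: stage_step => // W sW; apply: IH.
  by have -> : (alpha k - d = (alpha k - d.+1).+1)%N by lia.
move=> V; have := Hr (alpha k) V; by rewrite subnn.
Qed.

Lemma vanish_from_slice :
  (forall t, f (slice n alpha t) = 0) -> forall V, valid_rep V -> f V = 0.
Proof.
move=> h0.
have diag V : (forall r, stage n r V) -> f V = 0.
  move=> sV; have [vV Vr _] := sV 0%N.
  have Vn r : reduced r V.2 by have [_ _] := sV r; rewrite ltnn.
  (* Entries outside a matrix read as 0; [nz] turns them into 1, since the scaling argument asks for
     nonzero values at all positions. *)
  pose nz (x : K) := if x == 0 then 1 else x.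
  pose b i x := nz (if i == n then entry V.2 x x else entry (V.1 i) x x).
  have b0 i x : b i x != 0 by rewrite /b /nz; case: ifP => [_|/negbT//]; apply: oner_neq0.
  have ex x : exists y : K, y ^+ 2 == b n x.
    have [y e] := @solve_monicpoly K 2 (fun i => if i is 0 then b n x else 0) isT.
    by exists y; rewrite e !big_ord_recl big_ord0 /= expr0 mulr1 mul0r !addr0.
  have [|t et] := in_SpSI_diagrep hn b0 (rt := fun x => xchoose (ex x)) _ fS.
    by move=> x; apply/eqP/(xchooseP (ex x)).
  have -> : f V = f (diagrep n alpha b); last by rewrite et.
  have diagE m p (M : 'M[K]_(m, p)) : (forall r, reduced r M) ->
      M = dmx m p (fun x => nz (entry M x x)).
    move=> Mr; apply/matrixP=> x y; rewrite mxE.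
    have := Mr x.+1 x y; rewrite ltnSn /= => /(_ isT).
    case: eqP => [e|_ /eqP//]; rewrite -{1}e entryE => nz0.
    by rewrite /nz (negPf nz0).
  apply: (in_SpSI_agree hn fS) => //; first exact: valid_diagrep.
    move=> i hi /=; rewrite {1}(diagE _ _ (V.1 i)); last by apply: Vr; lia.
    by rewrite /b ltn_eqF //; lia.
  by rewrite /= {1}(diagE _ _ V.2) // /b eqxx.
(* Induction on [d] goes from the last vertex back to the first: a completely reduced matrix at one
   vertex puts the next vertex at its initial stage. *)
have H d V : (d < n)%N -> stage (n - d) 0 V -> f V = 0.
  elim: d V => [|d IH] V dn.
    by rewrite subn0; apply: stage_vanish => //; lia.
  apply: stage_vanish; first by lia.
  move=> W sW; apply: IH; first by lia.
  have [vW Wr _] := sW 0%N; split=> //; last by case: ifP => _ x y; rewrite !ltn0.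
  move=> i hi s; have [e|ne] := eqVneq i (n - d.+1)%N; last by apply: Wr; lia.
  have [_ _] := sW s; rewrite e; case: ifP => //; lia.
move=> V vV; apply: (H n.-1); first by lia.
split=> //; first by move=> i; lia.
by case: ifP => _ x y; rewrite !ltn0.
Qed.

End Elimination.

Theorem theorem2p3 (K : closedFieldType) (hK : [pchar K] =i pred0)
  (n : nat) (hn : (1 <= n)%N) (alpha : nat -> nat) :
  (forall f : SpRepT K n alpha -> K,
     @generator K n alpha f -> @in_SpSI K n alpha f) /\
  (forall f : SpRepT K n alpha -> K, @in_SpSI K n alpha f ->
     exists h : SpRepT K n alpha -> K,
       in_subalg (@generator K n alpha) h /\
       forall V : SpRepT K n alpha, @valid_rep K n alpha V -> f V = h V).
Proof.
split=> f fS; first exact: generator_in_SpSI.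
have K2 : (2%:R : K) != 0 by rewrite (pcharf0P K).1.
have [h ph fh] := in_SpSI_on_slice hn K2 fS.
exists h; split=> // V vV; apply/eqP; rewrite -subr_eq0; apply/eqP.
apply: (vanish_from_slice hn (in_SpSI_sub fS (subalg_in_SpSI hn ph))) => // t.
by rewrite fh subrr.
Qed.
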